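(* Let $\Omega$ be a countable algebraic language and $\mathbf{V}$ a nontrivial variety of $\Omega$-algebras. Then every finite $\mathbf{V}$-algebra has a finite big dual Ramsey degree with respect to Borel colorings in $\mathcal{F}_{\mathbf{V}}(\omega)$, the free $\mathbf{V}$-algebra on $\omega$ generators, taking the category $\mathbf{V}_{\mathit{epi}}$ of $\mathbf{V}$-algebras and epimorphisms as the ambient category. More precisely, for every finite algebra $\mathcal{A}\in\mathbf{V}$ with $n$ elements, $$ T^{\flat\partial}_{\mathbf{V}_{\mathit{epi}}}(\mathcal{A}, \mathcal{F}_{\mathbf{V}}(\omega)) \le n \cdot n!. $$
   Context: An algebraic language $\Omega$ is a set of constant and functional symbols (of finite arities). An $\Omega$-algebra is a nonempty set with an operation of the appropriate arity for each symbol of $\Omega$. A variety is the class of all $\Omega$-algebras satisfying some set of identities between $\Omega$-terms; it is nontrivial if it contains an algebra with at least two elements. Epimorphism of algebras means surjective homomorphism. $\mathcal{F}_{\mathbf{V}}(\omega)$ is the $\mathbf{V}$-algebra freely generated by countably infinitely many generators indexed by $\omega=\{0,1,2,\dots\}$. Each hom-set $\hom_{\mathbf{V}_{\mathit{epi}}}(\mathcal{A},\mathcal{B})$ carries the subspace topology inherited from the Tychonoff topology on $B^A$ with $A$ and $B$ discrete, $A,B$ being the underlying sets. A Borel $k$-coloring of a topological space $X$ is a map $\chi:X\to\{0,\dots,k-1\}$ such that each $\chi^{-1}(i)$ is a Borel set. For objects $\mathcal{A},\mathcal{S}$ of a category $\mathbf{B}$ with topologized hom-sets and continuous composition, $T^{\flat\partial}_{\mathbf{B}}(\mathcal{A},\mathcal{S})$,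 the big dual Ramsey degree of $\mathcal{A}$ in $\mathcal{S}$ with respect to Borel colorings, is the least positive integer $n$ such that for every $k\ge2$ and every Borel $k$-coloring $\chi$ of $\hom_{\mathbf{B}}(\mathcal{S},\mathcal{A})$ there is a $w\in\hom_{\mathbf{B}}(\mathcal{S},\mathcal{S})$ with $|\chi(\{f\cdot w:f\in\hom_{\mathbf{B}}(\mathcal{S},\mathcal{A})\})|\le n$; it is $\infty$ if there is no such $n$. *)

(* Defs.v *)
From HB Require Import structures.
From mathcomp Require Import all_boot all_order.
From mathcomp Require Import all_classical all_reals all_analysis.

Set Implicit Arguments.
Unset Strict Implicit.
Unset Printing Implicit Defensive.

Local Open Scope classical_set_scope.
Local Open Scope card_scope.

(* Constants are the symbols of arity 0. *)
Record language := Language { symbol : Type; arity : symbol -> nat }.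

Record algebra (Om : language) := Algebra {
  carrier :> Type;
  op : forall f : symbol Om, ('I_(arity f) -> carrier) -> carrier;
  algebra_nonempty : inhabited carrier }.
Arguments op {Om} a f _.

Inductive term (Om : language) :=
| Var (i : nat)
| App (f : symbol Om) (ts : 'I_(arity f) -> term Om).

Fixpoint term_eval (Om : language) (A : algebra Om) (v : nat -> A) (t : term Om) : A :=
  match t with
  | Var i => v i
  | App f ts => op A f (fun i => term_eval v (ts i))
  end.

Definition satisfies (Om : language) (A : algebra Om) (E : set (term Om * term Om)) :=
  forall e, E e -> forall v : nat -> A, term_eval v e.1 = term_eval v e.2.

Definition variety (Om : language) (V : algebra Om -> Prop) :=
  exists E : set (term Om * term Om), forall A, V A <-> satisfies A E.

Definition nontrivial (Om : language) (V : algebra Om -> Prop) :=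
  exists2 A : algebra Om, V A & exists x y : A, x <> y.

Definition homomorphism (Om : language) (A B : algebra Om) (h : A -> B) :=
  forall f (a : 'I_(arity f) -> A), h (op A f a) = op B f (fun i => h (a i)).

Definition epimorphism (Om : language) (A B : algebra Om) (h : A -> B) :=
  homomorphism h /\ forall y : B, exists x : A, h x = y.

Definition freely_generated (Om : language) (V : algebra Om -> Prop)
    (F : algebra Om) (x : nat -> F) :=
  V F /\
  forall B : algebra Om, V B -> forall g : nat -> B,
    exists! h : F -> B, homomorphism h /\ forall i, h (x i) = g i.

Record topCategory := TopCategory {
  obj :> Type;
  hom : obj -> obj -> topologicalType;
  idm : forall A, hom A A;
  compm : forall A B C, hom B C -> hom A B -> hom A C;
  compm_idl : forall A B (f : hom A B), compm (idm B) f = f;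
  compm_idr : forall A B (f : hom A B), compm f (idm A) = f;
  compm_assoc : forall A B C D (f : hom C D) (g : hom B C) (h : hom A B),
    compm f (compm g h) = compm (compm f g) h;
  compm_continuous : forall A B C,
    continuous (fun p : hom B C * hom A B => compm p.1 p.2) }.
Arguments hom {t} A B.
Arguments idm {t} A.
Arguments compm {t A B C} _ _.

Definition borel_coloring (X : topologicalType) (k : nat) (chi : X -> 'I_k) :=
  forall i : 'I_k, <<s [set U : set X | open U] >> (chi @^-1` [set i]).

(* [n] is an admissible value in the definition of the big dual Ramsey degree
   of [A] in [S], which is the least positive such [n]. *)
Definition dual_ramsey_bound (C : topCategory) (A S : C) (n : nat) :=
  forall k : nat, 2 <= k ->
  forall chi : hom S A -> 'I_k, borel_coloring chi ->
  exists w : hom S S, [set chi (compm f w) | f in [set: hom S A]] #<= `I_n.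

(* [None] stands for an infinite degree. *)
Definition big_dual_ramsey_degree (C : topCategory) (A S : C) : option nat :=
  match pselect (exists n, (0 < n) && `[< dual_ramsey_bound A S n >]) with
  | left ex => Some (ex_minn ex)
  | right _ => None
  end.

Section VarietyEpi.
Variables (Om : language) (V : algebra Om -> Prop).

Definition epi_set (A B : algebra Om) :
    set {ptws A -> discrete_topology {classic B}} :=
  [set h | @epimorphism Om A B h].
Arguments epi_set A B : clear implicits.

(* As a subtype of [{ptws A -> B}], this carries the subspace topology. *)
Definition epi (A B : algebra Om) : topologicalType := set_type (epi_set A B).

Lemma epimorphism_id (A : algebra Om) : epi_set A A idfun.
Proof. by split=> // y; exists y. Qed.

Lemma epimorphism_comp (A B C : algebra Om) (g : epi B C) (h : epi A B) :
  epi_set A C (set_val g \o set_val h).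
Proof.
have [gM gS] := set_mem (valP g); have [hM hS] := set_mem (valP h).
split=> [f a|z]; first by rewrite /= -gM; congr (set_val g _); exact: hM.
by have [y <-] := gS z; have [x <-] := hS y; exists x.
Qed.

Definition epi_id (A : algebra Om) : epi A A :=
  exist (fun h => h \in epi_set A A) _ (mem_set (epimorphism_id A)).

Definition epi_comp (A B C : algebra Om) (g : epi B C) (h : epi A B) : epi A C :=
  exist (fun h => h \in epi_set A C) _ (mem_set (epimorphism_comp g h)).

Lemma nbhs_epi (A B : algebra Om) (h : epi A B) (x : A) :
  nbhs h [set h' : epi A B | set_val h' x = set_val h x].
Proof.
have vC := @initial_continuous (epi_set A B) _ set_val h.
have pC := @proj_continuous {classic A} (fun=> discrete_topology {classic B}) x (set_val h).
have := pC _ (@discrete_set1 (discrete_topology {classic B}) (set_val h x)).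
move=> /vC; exact.
Qed.

Lemma epi_comp_continuous (A B C : algebra Om) :
  continuous (fun p : epi B C * epi A B => epi_comp p.1 p.2).
Proof.
apply: (@continuous_comp_initial (epi A C) _ _ set_val) => -[g h] /=.
apply/cvg_sup => x U [_ [[W _ <-] /= Wx] WU].
exists ([set g' : epi B C | set_val g' (set_val h x) = set_val g (set_val h x)],
        [set h' : epi A B | set_val h' x = set_val h x]).
  by split; exact: nbhs_epi.
move=> [g' h'] [/= gE hE]; apply: WU.
exact: (eq_ind_r W Wx (etrans (congr1 (set_val g') hE) gE)).
Qed.

Definition V_epi : topCategory.
Proof.
refine (@TopCategory {A : algebra Om | V A}
  (fun A B => epi (sval A) (sval B)) (fun A => epi_id (sval A))
  (fun A B C g h => epi_comp g h) _ _ _ _).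
- by move=> A B f; apply: val_inj.
- by move=> A B f; apply: val_inj.
- by move=> A B C D f g h; apply: val_inj.
- by move=> A B C; exact: epi_comp_continuous.
Defined.

End VarietyEpi.

(* Main.v *)
Require Import Defs.
From mathcomp Require Import all_boot all_order all_fingroup.
From mathcomp Require Import all_classical all_reals all_analysis.
From mathcomp Require Import zify.
Set Implicit Arguments.
Unset Strict Implicit.
Unset Printing Implicit Defensive.
Local Open Scope classical_set_scope.
Local Open Scope card_scope.

(** A homomorphism from the free algebra F on x_0, x_1, ... to A is the same
    thing as a map g : nat -> A, the images of the generators.  Listing the
    values of g in the order in which they first occur writes g as
    sigma \o h, where sigma is a permutation of A and h is a rigid map, that
    is, a map onto an initial segment {0, ..., l} of nat whose values first
    occur in increasing order.  There are n choices for l and n! for sigma,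
    hence at most n * n! types (l, sigma).  A rigid surjection w : nat -> nat
    induces an epimorphism x_i |-> x_(w i) of F, and precomposition with it
    turns sigma \o h into sigma \o (h \o w), of the same type.  So it is
    enough to find one w such that the colour of sigma \o h \o w depends on
    the type only.  Further refinement of w does no harm, so the finitely many
    types and colours can be treated one after the other, and what remains is
    the dual Ramsey theorem of Carlson and Simpson for a single Borel set X of
    rigid maps onto {0, ..., l - 1}.

    The proof of the latter works with finite words s, seen as initial
    segments of rigid maps, and refines w to u \o w where u is a rigid
    surjection that fixes the positions of s.  Say that w decides X at s when
    the maps h \o w, for h extending s, all lie in X or all lie outside X.

    If s already contains all l letters, some refinement of any given w
    decides X at s ([settled_sigma_algebra], [settled_open]).  This is clear
    for open sets and complements; for a union of sets X_i, a fusion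
    ([fusion]) decides X_i at all extensions of s by i letters simultaneously,
    and if one of these decisions is positive, a reindexing turns every
    extension of s into an extension of the word where it was made
    ([collapse]).

    If decisions can be made at words with i + 1 letters, they can be made at
    words with i letters ([settled_step]).  After a fusion, a word s with i
    letters gives a 2-colouring of the words t over these i letters, namely the
    decision made at s followed by t and the new letter.  The infinitary Hales-Jewett theorem of Carlson
    and Simpson ([carlson_simpson]) supplies a substitution that makes this
    colouring constant.  Descending to i = 0, that is, to the empty word,
    gives the dual Ramsey theorem ([settled_homogeneous]).

    The infinitary Hales-Jewett theorem is obtained from an idempotent
    ultrafilter on the semigroup of variable words that begin with the
    variable, chosen so that its images under all substitutions of a letter
    extend one maximal translation-invariant filter.  Closed subsemigroups and
    left ideals of the Stone-Cech compactification are represented by the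
    filters common to their points, so that Zorn's lemma for filters takes the
    place of compactness. *)

(** * Filters on words and idempotent ultrafilters *)

Lemma filterC_absurd T (F : set_system T) (A : set T) :
  ProperFilter F -> F A -> F (~` A) -> False.
Proof.
move=> PF FA FnA; apply: (filter_not_empty F).
by rewrite -(setICr A); apply: filterI.
Qed.

(** Zorn's lemma for conditions that hold of a filter as soon as each of its
    members passes a test which only gets easier when the filter grows: such
    conditions survive unions of chains. *)
Lemma maximal_filter T (P : set_system T -> set T -> Prop) (F0 : set_system T) :
  (forall F G X, ProperFilter F -> ProperFilter G -> F `<=` G ->
     P F X -> P G X) ->
  ProperFilter F0 -> F0 `<=` P F0 ->
  exists F, [/\ ProperFilter F, F0 `<=` F, F `<=` P F &
    forall G, ProperFilter G -> F `<=` G -> G `<=` P G -> G `<=` F].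
Proof.
move=> monoP PF0 F0P.
pose good F := [/\ ProperFilter F, F0 `<=` F & F `<=` P F].
(* set0 is allowed because it is the union of the empty chain. *)
have [|M [Mgood Mmax]] := @Zorn_bigcup _ [set F | F = set0 \/ good F].
  move=> C Cgood Ctot.
  have [[F [CF F_neq0]]|C0] := pselect (exists F, C F /\ F <> set0); last first.
    left; rewrite -subset0 => X [F CF FX]; apply: C0.
    by exists F; split=> // F_eq0; rewrite F_eq0 in FX.
  have goodC G X : C G -> G X -> good G.
    by move=> CG GX; have [G0|//] := Cgood _ CG; rewrite G0 in GX.
  have [X0 FX0] : F !=set0 by apply/set0P/eqP.
  have [PF F0F FP] := goodC _ _ CF FX0.
  have PU : ProperFilter (\bigcup_(G in C) id G).
    split; first by move=> [G CG G0]; have [[]] := goodC _ _ CG G0.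
    split; first by exists F => //; apply: filterT.
      move=> X Y [G CG GX] [H CH HY].
      have [GH|HG] := Ctot _ _ CG CH.
        exists H => //; have [? _ _] := goodC _ _ CH HY.
        by apply: filterI => //; apply: GH.
      exists G => //; have [? _ _] := goodC _ _ CG GX.
      by apply: filterI => //; apply: HG.
    move=> X Y XY [G CG GX]; exists G => //; have [? _ _] := goodC _ _ CG GX.
    exact: filterS XY GX.
  right; split=> // [X F0X|X [G CG GX]]; first by exists F => //; apply: F0F.
  have [PG _ GP] := goodC _ _ CG GX.
  by apply: monoP (GP _ GX) => // Y GY; exists G.
have [M0|[PM F0M MP]] := Mgood.
  exfalso; apply: (Mmax F0); last by right; split.
  rewrite M0; split; first exact: sub0set.
  by move=> /(_ setT filterT).
exists M; split=> // G PG MG GP X GX; apply: contrapT => MX.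
apply: (Mmax G); first by split=> // GM; apply: MX; apply: GM.
by right; split=> //; exact: subset_trans MG.
Qed.

Section Words.
Variable T : Type.
Implicit Types (X Y Z : set (seq T)) (F G : set_system (seq T)).

Definition lquot X x := [set y | X (x ++ y)].

Lemma lquot_cat X x y : lquot X (x ++ y) = lquot (lquot X x) y.
Proof. by rewrite /lquot predeqE => z /=; rewrite catA. Qed.

(** On ultrafilters this is the product of the Stone-Cech compactification of
    the free semigroup. *)
Definition fmul F G := [set X | F [set x | G (lquot X x)]].

Lemma fmul_proper F G :
  ProperFilter F -> ProperFilter G -> ProperFilter (fmul F G).
Proof.
move=> PF PG; split; rewrite /fmul /=.
  rewrite (_ : [set x | _] = set0); first exact: filter_not_empty.
  by rewrite -subset0 => x; exact: filter_not_empty.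
split => [|X Y FX FY|X Y XY] /=.
- by apply: (@filterS _ F) filterT => x _; exact: filterT.
- by apply: (@filterS2 _ F) FX FY => x; exact: filterI.
- by apply: (@filterS _ F) => x; apply: filterS => y; exact: XY.
Qed.

Lemma fmul_mono F F' G G' : ProperFilter F ->
  F `<=` F' -> G `<=` G' -> fmul F G `<=` fmul F' G'.
Proof.
move=> PF FF' GG' X FX; apply: FF'.
by apply: (@filterS _ F) FX => x; exact: GG'.
Qed.

Lemma fmulA F G H : fmul F (fmul G H) = fmul (fmul F G) H.
Proof.
rewrite predeqE => X; rewrite /fmul /=.
suff -> : (fun x => G [set y | H (lquot (lquot X x) y)]) =
          (fun x => G (lquot [set z | H (lquot X z)] x)) by [].
apply/funext => x; congr G; apply/funext => y /=; congr H.
by rewrite -lquot_cat.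
Qed.

(** Ellis' lemma.  The filters [F] with [F `<=` fmul F F] are those whose
    ultrafilter extensions form a closed subsemigroup, so a maximal one stands
    for a minimal subsemigroup K.  For q in K both K q and the stabilizer
    {r in K | r q = q} are closed subsemigroups contained in K, hence equal to
    K, so that q q = q. *)
Lemma idempotent_ultrafilter F0 :
  ProperFilter F0 -> F0 `<=` fmul F0 F0 ->
  exists q, [/\ UltraFilter q, F0 `<=` q & q `<=` fmul q q].
Proof.
move=> PF0 F0S.
have [F G X PF _ FG|F [PF F0F FS Fmax]] :=
    @maximal_filter _ (fun F => fmul F F) F0 _ PF0 F0S.
  exact: fmul_mono.
have [q [Uq Fq]] := ultraFilterLemma PF.
(* K q = K, where K is the set of ultrafilters extending F. *)
have FqF : fmul F q `<=` F.
  apply: Fmax; first exact: fmul_proper.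
    by apply: (subset_trans FS); exact: fmul_mono.
  have FqFF : F `<=` fmul F (fmul q F).
    apply: (subset_trans FS); apply: fmul_mono => //.
    by apply: (subset_trans FS); exact: fmul_mono.
  by rewrite fmulA -(fmulA F q F); apply: fmul_mono => //; exact: fmul_proper.
pose R Z := [set x | q (lquot Z x)].
exists q; split=> //; first exact: subset_trans Fq.
(* the filter whose ultrafilter extensions form the stabilizer of q in K *)
pose F2 := [set Y | exists Z Y0, [/\ q Z, F Y0 & R Z `&` Y0 `<=` Y]].
have PF2 : ProperFilter F2.
  split.
    move=> [Z [Y0 [qZ FY0 ZY0]]].
    apply: (@filterC_absurd _ q Z) => //; apply: Fq; apply: FqF.
    apply: filterS FY0 => x Y0x; rewrite /lquot /=.
    have [qx|//] := in_ultra_setVsetC (lquot Z x) Uq.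
    by exfalso; apply: (ZY0 x); split.
  split.
  - by exists setT, setT; split=> //; exact: filterT.
  - move=> X Y [Z [Y0 [qZ FY0 ZX]]] [Z' [Y0' [qZ' FY0' ZY]]].
    exists (Z `&` Z'), (Y0 `&` Y0'); split; [exact: filterI|exact: filterI|].
    move=> x [ZZ' [Y0x Y0'x]]; split; [apply: ZX|apply: ZY]; split=> //.
      by apply: filterS ZZ' => y [].
    by apply: filterS ZZ' => y [].
  - move=> X Y XY [Z [Y0 [qZ FY0 ZX]]]; exists Z, Y0; split=> //.
    exact: subset_trans XY.
have FF2 : F `<=` F2.
  move=> Y FY; exists setT, Y; split=> //; exact: filterT.
have RF2 Z : q Z -> F2 (R Z).
  by move=> qZ; exists Z, setT; split=> //; exact: filterT.
have F2F : F2 `<=` F.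
  apply: Fmax => // Y [Z [Y0 [qZ FY0 ZY]]].
  have PF22 := fmul_proper PF2 PF2.
  apply: filterS ZY _; apply: filterI; last first.
    by apply: (fmul_mono PF FF2 FF2); exact: FS.
  apply: filterS (RF2 _ qZ) => x qx.
  by apply: filterS (RF2 _ qx) => y; rewrite {2}/lquot /R /= lquot_cat.
by move=> Z qZ; apply: Fq; apply: F2F; exact: RF2.
Qed.
End Words.

Lemma filter_forall (T : Type) (F : set_system T) (J : finType) (P : J -> set T) :
  Filter F -> (forall j, F (P j)) -> F [set x | forall j, P j x].
Proof.
move=> FF FP.
suff H (s : seq J) : F [set x | forall j, j \in s -> P j x].
  by apply: filterS (H (enum J)) => x Px j; apply: Px; rewrite mem_enum.
elim: s => [|j s IH]; first by apply: (@filterS _ F) filterT.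
apply: filterS2 (FP j) IH => x Pj Ps i; rewrite inE => /predU1P[->//|].
exact: Ps.
Qed.

(** * The infinitary Hales-Jewett theorem *)

Section VariableWords.
Variable T : Type.

(** In a word over [option T], [None] is the variable. *)
Definition instance (a : T) (u : seq (option T)) : seq T := map (odflt a) u.

(** Each block begins with its variable.  Hence the word obtained from the
    first [r] blocks ends exactly where the variable of the next block first
    occurs, so that substituting the blocks into a word takes a prefix ending
    before the [r]-th variable to a prefix of the same kind. *)
Fixpoint fill (w : nat -> seq (option T)) (tau : nat -> T) r : seq T :=
  if r is r'.+1 then fill w tau r' ++ instance (tau r') (None :: w r') else [::].

End VariableWords.

Section CarlsonSimpson.
Variable T : finType.

(** Translation-invariant filters stand for closed left ideals, so a maximal
    one stands for a minimal left ideal.  The last clause says that the left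
    ideal generated by any point [e] of it is all of it. *)
Lemma maximal_invariant_filter : exists F : set_system (seq T),
  [/\ ProperFilter F, forall X, F X -> forall x, F (lquot X x) &
    forall e : set_system (seq T), ProperFilter e -> F `<=` e ->
      forall X, (forall x, e (lquot X x)) -> F X].
Proof.
have PF0 : ProperFilter [set [set: seq T]].
  split; first by move=> /seteqP[_ /(_ [::])]; exact.
  by split=> //= [X Y -> ->|X Y XY XT]; [rewrite setIT|rewrite -subTset -XT].
have [F G X _ _ FG FX x||F [PF _ FP Fmax]] :=
    @maximal_filter _ (fun F X => forall x, F (lquot X x)) _ _ PF0.
- exact/FG/FX.
- by move=> X /= -> x.
exists F; split=> // e Pe Fe X eX.
apply: (Fmax [set X | forall x, e (lquot X x)]) => //.
- split=> [/(_ [::])|]; first exact: filter_not_empty.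
  split=> [x|Y Z eY eZ x|Y Z YZ eY x]; first exact: filterT.
    by apply: filterI; [exact: eY|exact: eZ].
  by apply: filterS (eY x) => y; exact: YZ.
- by move=> Y FY x; apply: Fe; exact: FP.
- by move=> Y eY x y; rewrite -lquot_cat.
Qed.

(** The variable words that begin with the variable and all of whose instances
    lie in a given member of [F] generate a filter to which Ellis' lemma
    applies.  It is proper because an invariant proper filter has, in each of
    its members, words [a :: y] with the same [y] for all letters [a]; the
    variable word [None :: y] is then as required. *)
Lemma left_variable_idempotent (F : set_system (seq T)) :
  ProperFilter F -> (forall X, F X -> forall x, F (lquot X x)) ->
  exists q : set_system (seq (option T)),
    [/\ UltraFilter q, q `<=` fmul q q, q [set u | exists v, u = None :: v] &
      forall a X, F X -> q [set u | X (instance a u)]].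
Proof.
move=> PF FP.
pose B X := [set u | (exists v, u = None :: v) /\ forall a : T, X (instance a u)].
pose F0 := [set Y | exists2 X, F X & B X `<=` Y].
have PF0 : ProperFilter F0.
  split; first move=> [X FX BX0].
    have : F [set y | forall a : T, X (a :: y)].
      by apply: filter_forall => a; exact: (FP _ FX [:: a]).
    move=> /filter_ex[y Xy]; apply: (BX0 (None :: map Some y)).
    split; first by exists (map Some y).
    by move=> a; rewrite /instance /= -map_comp (eq_map (g := id)) ?map_id.
  split; first by exists setT => //; exact: filterT.
    move=> Y Z [X FX XY] [X' FX' XZ]; exists (X `&` X'); first exact: filterI.
    move=> u [Lu Xu]; split; [apply: XY|apply: XZ]; split=> // a.
      by have [] := Xu a.
    by have [] := Xu a.
  by move=> Y Z YZ [X FX XY]; exists X => //; exact: subset_trans YZ.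
have [|q [Uq F0q qq]] := @idempotent_ultrafilter _ F0 PF0.
  move=> Y [X FX XY]; exists X => // u [[v ->] Xu].
  exists [set y | forall a : T, X (instance a (None :: v) ++ y)].
    by apply: filter_forall => a; exact: FP.
  move=> u' [_ Xu']; apply: XY; split; first by exists (v ++ u').
  by move=> a; rewrite /instance map_cat; exact: Xu'.
exists q; split=> //.
  by apply: F0q; exists setT; [exact: filterT|move=> u []].
by move=> a X FX; apply: F0q; exists X => // u [_]; exact.
Qed.

(** Let [e a] be the image of the idempotent [q] under substitution of [a]; it
    is an idempotent in the left ideal of [F].  Minimality gives r (e a) = r
    for every r in this ideal, which in terms of [F] says that for [F]-almost
    all [x], [X x] holds iff [X (x ++ y)] holds for [e a]-almost all [y].  Let
    [G] be the set of these [x], for all [a] at once.  From [w0] in [G],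
    blocks are added one by one while staying in [G] and on the same side of
    [X]. *)
Theorem carlson_simpson (X : set (seq T)) :
  exists (w0 : seq T) (w : nat -> seq (option T)) (eps : bool),
    forall tau r, X (w0 ++ fill w tau r) <-> eps.
Proof.
have [F [PF FP Fmax]] := maximal_invariant_filter.
have [q [Uq qq qL qF]] := left_variable_idempotent PF FP.
pose e a := [set Y | q [set u | Y (instance a u)]].
have FeX a Y : F [set x | Y x <-> e a (lquot Y x)].
  apply: (Fmax (e a)); last first.
  - move=> x; rewrite /e /=.
    have [qx|qx] := in_ultra_setVsetC [set u | Y (x ++ instance a u)] Uq.
      apply: filterS2 qx (qq _ qx) => u Yu qu; split=> // _.
      by apply: filterS qu => v; rewrite /lquot /= /instance map_cat catA.
    apply: filterS2 qx (qq _ qx) => u Yu qu; split=> // qu'.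
    exfalso; apply: (filterC_absurd _ qu').
    by apply: filterS qu => v; rewrite /lquot /= /instance map_cat catA.
  - by move=> Z FZ; exact: qF.
pose G (X : set (seq T)) := [set x | forall a, X x <-> e a (lquot X x)].
have FG : F (G X) by exact: (filter_forall _ (fun a => FeX a X)).
have [w0 Gw0] := filter_ex FG.
wlog Xw0 : X FG Gw0 / X w0.
  move=> W; have [Xw0|Xw0] := pselect (X w0); first exact: (W X).
  have CX a x : e a (lquot (~` X) x) <-> ~ e a (lquot X x).
    split=> [enX eX|eX]; first exact: (filterC_absurd _ eX).
    by have [] := in_ultra_setVsetC [set u | lquot X x (instance a u)] Uq.
  have GC x : G X x -> G (~` X) x.
    by move=> Gx a; rewrite CX /setC /=; have := Gx a; tauto.
  have FGC : F (G (~` X)) by apply: filterS FG => x; exact: GC.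
  have [v0 [v [eps vE]]] := W (~` X) FGC (GC _ Gw0) Xw0.
  exists v0, v, (~~ eps) => tau r; have := vE tau r.
  case: eps {vE} => /= [[_ /(_ isT)]|[H _]] //.
  by split=> // _; apply: contrapT => /H.
pose XG := X `&` G X.
(* one block that extends finitely many words simultaneously *)
have next (s : seq (seq T)) : exists u, (forall x, x \in s -> XG x) ->
    forall x a, x \in s -> XG (x ++ instance a (None :: u)).
  have [sXG|nsXG] := pselect (forall x, x \in s -> XG x); last by exists [::].
  suff : q [set u | forall x, x \in s -> forall a, XG (x ++ instance a u)].
    move=> /(filterI qL) /filter_ex[_ [[u ->] su]].
    by exists u => _ x a xs; exact: su.
  elim: s sXG => [|x s IH] sXG; first by apply: (@filterS _ q) filterT.
  have qx : q [set u | forall a, XG (x ++ instance a u)].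
    apply: filter_forall => a; apply: filterI.
      by have [Xx Gx] := sXG _ (mem_head _ _); exact: (Gx a).1.
    exact: (qF _ _ (FP _ FG x)).
  apply: filterS2 qx (IH _) => [u xu su y|y ys].
    by rewrite inE => /predU1P[->//|]; exact: su.
  by apply: sXG; rewrite inE ys orbT.
have [nu nuP] := choice next.
pose ext s := [seq x ++ instance a (None :: nu s) | x <- s, a <- enum T].
pose st n := iter n ext [:: w0].
exists w0, (nu \o st), true => tau r; split=> // _.
have XGst n x : x \in st n -> XG x.
  elim: n x => [|n IH] x; first by rewrite inE => /eqP ->.
  by move=> /allpairsP[[y a] /= [yst _ ->]]; exact: nuP.
suff : w0 ++ fill (nu \o st) tau r \in st r by move=> /XGst[].
elim: r => [|r IH]; first by rewrite cats0 mem_head.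
rewrite /= catA; apply/allpairsP; exists (w0 ++ fill (nu \o st) tau r, tau r).
by split=> //=; rewrite mem_enum.
Qed.

End CarlsonSimpson.

(** * Rigid maps and fusion *)

Definition rigid (h : nat -> nat) :=
  forall m k, k < h m -> exists2 m', m' < m & h m' = k.

Definition rigid_surj (u : nat -> nat) := rigid u /\ forall k, exists m, u m = k.

Definition rigid_onto l (h : nat -> nat) :=
  rigid h /\ forall k, (exists m, h m = k) <-> k < l.

Definition fixes j (u : nat -> nat) := forall m, m < j -> u m = m.

Definition extends (h : nat -> nat) (s : seq nat) :=
  forall m, m < size s -> h m = nth 0 s m.

Lemma rigid_comp h u : rigid h -> rigid u -> rigid (h \o u).
Proof.
move=> hR uR m k /hR[c cm <-]; have [m' m'm <-] := uR _ _ cm.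
by exists m'.
Qed.

Lemma rigid_surj_id : rigid_surj id.
Proof. by split=> [m k km|k]; exists k. Qed.

Lemma rigid_surj_comp u v : rigid_surj u -> rigid_surj v -> rigid_surj (u \o v).
Proof.
move=> [uR uS] [vR vS]; split; first exact: rigid_comp.
by move=> k; have [m <-] := uS k; have [m' <-] := vS m; exists m'.
Qed.

Lemma rigid_onto_comp l h u :
  rigid_onto l h -> rigid_surj u -> rigid_onto l (h \o u).
Proof.
move=> [hR hS] [uR uS]; split; first exact: rigid_comp.
move=> k; rewrite -hS; split=> [[m <-]|[m <-]]; first by exists (u m).
by have [m' <-] := uS m; exists m'.
Qed.

Lemma rigid_onto_lt l h m : rigid_onto l h -> h m < l.
Proof. by case=> _ hS; apply/hS; exists m. Qed.

Lemma rigid_le u m : rigid u -> u m <= m.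
Proof.
move=> uR; elim/ltn_ind: m => m IH; rewrite leqNgt; apply/negP.
by move=> /uR[m' m'm um']; have := IH _ m'm; rewrite um' leqNgt m'm.
Qed.

Lemma fixes_le i j u : i <= j -> fixes j u -> fixes i u.
Proof. by move=> ij uj m mi; apply: uj; exact: leq_trans mi ij. Qed.

Lemma fixes_comp j u v : fixes j u -> fixes j v -> fixes j (u \o v).
Proof. by move=> uj vj m mj; rewrite /= vj // uj. Qed.

Lemma extends_comp h s u : extends h s -> fixes (size s) u -> extends (h \o u) s.
Proof. by move=> hs us m ms; rewrite /= us // hs. Qed.

(** The limit is the infinite composite ... \o u 2 \o u 1 \o u 0, and [v N] is
    its tail starting at [u N].  Rigid maps satisfy [u m <= m], so the value at
    [m] no longer changes once the maps fix everything up to [m].  All late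
    enough maps fix a given [k], so a position of the value [k] persists, which
    makes the limit surjective. *)
Lemma rigid_surj_limit j0 (u : nat -> nat -> nat) :
  (forall N, rigid_surj (u N)) -> (forall N, fixes (j0 + N) (u N)) ->
  exists v : nat -> nat -> nat, forall N,
    [/\ rigid_surj (v N), fixes (j0 + N) (v N) & v N = v N.+1 \o u N].
Proof.
move=> uRS ufix.
pose fix c N k := if k is k'.+1 then c N.+1 k' \o u N else id.
have cRS N k : rigid_surj (c N k).
  elim: k N => [|k IH] N; first exact: rigid_surj_id.
  by apply: rigid_surj_comp.
have cfix N k : fixes (j0 + N) (c N k).
  elim: k N => [|k IH] N //; apply: fixes_comp => //.
  by apply: fixes_le (IH N.+1); rewrite leq_add2l.
have cD k1 k2 N m : c N (k1 + k2) m = c (N + k1) k2 (c N k1 m).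
  elim: k1 N m => [|k1 IH] N m; first by rewrite addn0.
  by rewrite addSn /= IH addSnnS.
have cstable N k m : m < k -> c N k m = c N m.+1 m.
  move=> mk; rewrite -(subnKC mk) cD cfix //.
  by apply: leq_ltn_trans (rigid_le _ (cRS _ _).1) _; lia.
exists (fun N m => c N m.+1 m) => N; split.
- split=> [m k|k].
    move=> /((cRS _ _).1)[m' m'm cm'].
    by exists m' => //; rewrite -(@cstable N m.+1 m') // ltnW.
  have [p cp] := (cRS N k.+1).2 k; exists p.
  rewrite -(@cstable N (k.+1 + p.+1)); last by lia.
  by rewrite cD cp cfix; lia.
- by move=> m mj; rewrite cfix.
- apply/funext => m; rewrite -(@cstable N m.+2) //.
  rewrite -[LHS]/(c N.+1 m.+1 (u N m)) cstable // ltnS.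
  exact: rigid_le (uRS N).1.
Qed.

Fixpoint words l N : seq (seq nat) :=
  if N is N'.+1 then [seq k :: s | k <- iota 0 l, s <- words l N'] else [:: [::]].

Lemma mem_words l s : all (gtn l) s -> s \in words l (size s).
Proof.
elim: s => //= k s IH /andP[kl sl]; apply/allpairsP; exists (k, s).
by split=> //=; [rewrite mem_iota|exact: IH].
Qed.

Lemma words_size l N s : s \in words l N -> size s = N /\ all (gtn l) s.
Proof.
elim: N s => [|N IH] s; first by rewrite inE => /eqP ->.
move=> /allpairsP[[k t] /= [kl /IH[<- tl] ->]]; split=> //=.
by rewrite tl andbT; move: kl; rewrite mem_iota.
Qed.

(** Stage [N] treats the finitely many words of length [j0 + N] and leaves
    these positions alone from then on, so the decisions survive in the
    limit. *)
Lemma fusion l (D : seq nat -> (nat -> nat) -> Prop) j0 :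
  (forall s w, all (gtn l) s -> rigid_surj w ->
     exists u, [/\ rigid_surj u, fixes (size s) u & D s (u \o w)]) ->
  (forall s u w, rigid_surj u -> fixes (size s) u -> D s w -> D s (u \o w)) ->
  forall w, rigid_surj w -> exists u, [/\ rigid_surj u, fixes j0 u &
    forall s, j0 <= size s -> all (gtn l) s -> D s (u \o w)].
Proof.
move=> Ddense Dhered w wRS.
have stage (p : nat * (nat -> nat)) : exists u, rigid_surj p.2 ->
    [/\ rigid_surj u, fixes p.1 u & forall s, s \in words l p.1 -> D s (u \o p.2)].
  case: p => N w' /=.
  have [w'RS|] := pselect (rigid_surj w'); last by exists id.
  suff [u ?] : exists u, [/\ rigid_surj u, fixes N u &
      forall s, s \in words l N -> D s (u \o w')] by exists u.
  have : forall s, s \in words l N -> size s = N /\ all (gtn l) s.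
    by move=> s; exact: words_size.
  elim: (words l N) => [|s ss IH] ssP.
    by exists id; split=> //; exact: rigid_surj_id.
  have [|u [uRS uN uss]] := IH.
    by move=> t tss; apply: ssP; rewrite inE tss orbT.
  have [sN sl] := ssP s (mem_head _ _).
  have [v [vRS vN vs]] := Ddense s (u \o w') sl (rigid_surj_comp uRS w'RS).
  rewrite sN in vN; exists (v \o u); split.
  - exact: rigid_surj_comp.
  - exact: fixes_comp.
  - move=> t; rewrite inE => /predU1P[->//|tss].
    apply: (Dhered _ v (u \o w')) => //; last exact: uss.
    by have [|-> _] := ssP t; first by rewrite inE tss orbT.
have [U UP] := choice stage.
pose fix c N := if N is N'.+1 then U (j0 + N', c N') \o c N' else w.
pose u N := U (j0 + N, c N).
have cRS N : rigid_surj (c N).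
  elim: N => //= N IH; have [URS _ _] := UP (j0 + N, c N) IH.
  exact: rigid_surj_comp.
have uP N : [/\ rigid_surj (u N), fixes (j0 + N) (u N) &
    forall s, s \in words l (j0 + N) -> D s (u N \o c N)].
  exact: (UP (j0 + N, c N) (cRS N)).
have [v vP] : exists v : nat -> nat -> nat, forall N,
    [/\ rigid_surj (v N), fixes (j0 + N) (v N) & v N = v N.+1 \o u N].
  by apply: rigid_surj_limit => N; case: (uP N).
have v0 N : v 0 \o w = v N \o c N.
  elim: N => // N ->; have [_ _ ->] := vP N; exact/funext.
exists (v 0); have [v0RS v0fix _] := vP 0; split=> //.
  by rewrite addn0 in v0fix.
move=> s js sl; rewrite (v0 (size s - j0).+1).
have [vRS vfix _] := vP (size s - j0).+1.
apply: Dhered => //; first by apply: fixes_le vfix; lia.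
by have [_ _] := uP (size s - j0); apply; rewrite subnKC //; exact: mem_words.
Qed.

Lemma extends_map h v s : extends v s -> extends (h \o v) (map h s).
Proof.
by move=> vs m; rewrite size_map => ms; rewrite (nth_map 0) //= vs.
Qed.

Lemma extends_cat h s t : extends h (s ++ t) -> extends h s.
Proof.
by move=> hst m ms; rewrite hst ?nth_cat ?ms // size_cat ltn_addr.
Qed.

Lemma map_extends h s : extends h s -> map h (iota 0 (size s)) = s.
Proof.
move=> hs; apply: (@eq_from_nth _ 0); rewrite size_map size_iota // => m ms.
by rewrite (nth_map 0) ?size_iota // nth_iota // hs.
Qed.

(** * Substitutions as rigid surjections *)

Section Substitution.
Variables (T : eqType) (lab : T -> nat) (s : seq nat).
Variables (t : seq T) (w : nat -> seq (option T)).
Hypothesis lab_t : forall a, a \in t -> lab a \in s.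
Hypothesis lab_w : forall r a, Some a \in w r -> lab a \in s.

Let j := size s.
Let lift a := index (lab a) s.

(** A map [h] extending [s] takes the value [lab a] at the position of [lab a]
    in [s], and its values at [j], [j + 1], ... are unconstrained.  A letter
    of the given words is thus encoded by the first position of its label in
    [s], and the variable of the [r]-th block by the position [j + r]. *)
Fixpoint prefixes r :=
  if r is r'.+1 then prefixes r' ++ (j + r') :: map (oapp lift (j + r')) (w r')
  else iota 0 j ++ map lift t.

Lemma size_prefixes r : j + r <= size (prefixes r).
Proof.
elim: r => [|r IH] /=; first by rewrite size_cat size_iota; lia.
by rewrite size_cat /=; lia.
Qed.

Lemma nth_prefixes r d m :
  m < size (prefixes r) -> nth 0 (prefixes (r + d)) m = nth 0 (prefixes r) m.
Proof.
move=> mr; elim: d => [|d IH]; first by rewrite addn0.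
rewrite addnS /= nth_cat -IH.
suff -> : m < size (prefixes (r + d)) by [].
elim: d {IH} => [|d IH]; first by rewrite addn0.
by rewrite addnS /= size_cat ltn_addr.
Qed.

Lemma mem_prefixes r k : k < j + r -> k \in prefixes r.
Proof.
elim: r => [|r IH] /= kr; first by rewrite mem_cat mem_iota; lia.
rewrite mem_cat inE; move: kr; rewrite addnS ltnS leq_eqVlt => /predU1P[->|/IH->//].
by rewrite eqxx orbT.
Qed.

Lemma rigid_prefixes r m k : m < size (prefixes r) -> k < nth 0 (prefixes r) m ->
  exists2 m', m' < m & nth 0 (prefixes r) m' = k.
Proof.
elim: r => [|r IH] /=; rewrite size_cat nth_cat /=.
  rewrite size_iota size_map; case: (ltnP m j) => [mj _|jm mjt].
    rewrite nth_iota // => km; exists k => //.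
    by rewrite nth_cat size_iota (ltn_trans km mj) nth_iota // (ltn_trans km mj).
  have mt : m - j < size t by lia.
  have tn0 : size t != 0 by lia.
  case: t mt lab_t => // a0 t' mt lab_t'.
  rewrite (nth_map a0) // => ks.
  have kj : k < j.
    by apply: ltn_trans ks _; rewrite index_mem; apply: lab_t'; exact: mem_nth.
  exists k; first exact: leq_trans kj jm.
  by rewrite nth_cat size_iota kj nth_iota.
rewrite size_map; case: (ltnP m (size _)) => [mr _ km|rm mr km].
  have [m' m'm <-] := IH mr km; exists m' => //.
  by rewrite nth_cat (ltn_trans m'm mr).
have kr : k \in prefixes r.
  apply: mem_prefixes; apply: leq_trans km _.
  case: (m - _) (mr) => //= d.
  have [dw _|wd _] := ltnP d (size (w r)); last first.
    by rewrite nth_default ?size_map.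
  rewrite (nth_map None) //; have := mem_nth None dw.
  case: (nth None (w r) d) => //= a /lab_w; rewrite -index_mem => aj.
  by apply: leq_trans (ltnW aj) _; exact: leq_addr.
have := kr; rewrite -index_mem => ir.
exists (index k (prefixes r)); first exact: leq_trans ir rm.
by rewrite nth_cat ir nth_index.
Qed.

(** The final [h (size s + R)] is the variable that opens the block [w R]. *)
Lemma substitution : exists v, [/\ rigid_surj v, fixes (size s) v &
  forall h tau R, extends h s -> (forall r, r < R -> lab (tau r) = h (size s + r)) ->
    extends (h \o v)
      (rcons (s ++ map lab (t ++ fill w tau R)) (h (size s + R)))].
Proof.
pose v m := nth 0 (prefixes m.+1) m.
have mlt m : m < size (prefixes m.+1).
  by apply: leq_trans (size_prefixes _); rewrite addnS ltnS leq_addl.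
have vE r : extends v (prefixes r).
  move=> m mr; have [mr'|rm] := leqP m.+1 r.
    by rewrite -(subnKC mr') nth_prefixes.
  by rewrite /v -(subnKC (ltnW rm)) nth_prefixes.
exists v; split.
- split=> [m k /(rigid_prefixes (mlt m))[m' m'm <-]|k].
    exists m' => //; apply: vE; exact: ltn_trans m'm (mlt m).
  have : k \in prefixes k.+1 by apply: mem_prefixes; lia.
  rewrite -index_mem => ks; exists (index k (prefixes k.+1)).
  by rewrite (vE k.+1) // nth_index // -index_mem.
- move=> m mj; rewrite (vE 0) /= ?size_cat ?size_iota ?ltn_addr //.
  by rewrite nth_cat size_iota mj nth_iota.
move=> h tau R hs tauE.
have liftE a : lab a \in s -> h (lift a) = lab a.
  by move=> sa; rewrite /lift hs ?index_mem // nth_index.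
have <- : map h (rcons (prefixes R) (j + R)) =
    rcons (s ++ map lab (t ++ fill w tau R)) (h (size s + R)).
  rewrite map_rcons; congr rcons; elim: R tauE => [|R IH] tauE /=.
    rewrite !map_cat map_extends // cats0 -map_comp; congr cat.
    by apply/eq_in_map => a at_; rewrite /= liftE ?lab_t.
  rewrite map_cat IH => [|r rR]; last by rewrite tauE // ltnW.
  rewrite !map_cat !catA; congr cat; rewrite /= tauE //; congr cons.
  rewrite /instance -!map_comp; apply/eq_in_map => -[a aw|_] /=.
    by rewrite liftE // (lab_w aw).
  by rewrite tauE.
apply: extends_map; apply: (@extends_cat _ _ (map (oapp lift (j + R)) (w R))).
by rewrite cat_rcons; exact: (vE R.+1).
Qed.

End Substitution.

(** * The descent on the number of letters *)

Definition letters i (s : seq nat) := forall k, (k \in s) = (k < i).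

(** [Q true] and [Q false] will be a set and its complement, except that both
    contain the maps [nat -> nat] that come from no epimorphism. *)
Definition decided (Q : bool -> set (nat -> nat)) l s w :=
  exists eps, forall h, rigid_onto l h -> extends h s -> Q eps (h \o w).

Definition settled Q l i := forall w s, rigid_surj w -> letters i s ->
  exists u, [/\ rigid_surj u, fixes (size s) u & decided Q l s (u \o w)].

Lemma decided_comp Q l s u w : rigid_surj u -> fixes (size s) u ->
  decided Q l s w -> decided Q l s (u \o w).
Proof.
move=> uRS us [eps Qeps]; exists eps => h hl hs.
by apply: (Qeps (h \o u)); [exact: rigid_onto_comp|exact: extends_comp].
Qed.

Lemma first_occurrence l i h s : i < l -> letters i s -> rigid_onto l h ->
  extends h s -> exists R, h (size s + R) = i /\
    forall r, r < R -> h (size s + r) < i.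
Proof.
move=> il si [hR hS] hs.
have ex : exists m, h m == i by have [m hm] := (hS i).2 il; exists m; apply/eqP.
have [m /eqP hm mmin] := ex_minnP ex.
have sm : size s <= m.
  rewrite leqNgt; apply/negP => ms.
  by have := mem_nth 0 ms; rewrite -hs // hm si ltnn.
exists (m - size s); rewrite subnKC //; split=> // r rm.
rewrite ltnNge leq_eqVlt; apply/negP => /predU1P[hi|/hR[m' m'r hm']].
  by have := mmin (size s + r); rewrite -hi eqxx => /(_ isT); lia.
by have := mmin m'; rewrite hm' eqxx => /(_ isT); lia.
Qed.

(** After a fusion, the words with the letters up to [i] are decided.  For a
    word [s] with the letters below [i], an extension of [s] first reaches the
    letter [i] after some word [t] over the smaller letters; substituting the
    blocks of [carlson_simpson] makes the decision independent of [t]. *)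
Lemma settled_step Q l i : i < l -> settled Q l i.+1 -> settled Q l i.
Proof.
move=> il Qi w s wRS si.
case: i il Qi si => [|i] il Qi si.
  (* Every rigid map starts with 0, so [:: 0] is its only one-letter start. *)
  have s0 : s = [::].
    by case: s si => // k s /(_ k); rewrite mem_head ltn0.
  have [|u [uRS ufix [eps Qeps]]] := Qi w [:: 0] wRS.
    by move=> k; rewrite inE ltnS leqn0.
  exists u; split; [exact: uRS|by rewrite s0|].
  exists eps => h hl _; apply: Qeps => // -[|//] _ /=.
  by apply/eqP; rewrite -leqn0; exact: rigid_le hl.1.
pose D s' w' := letters i.+2 s' -> decided Q l s' w'.
have [||u0 [u0RS u0fix u0D]] := @fusion i.+2 D (size s) _ _ w wRS.
- move=> s' w' _ w'RS; have [s'i|ns'i] := pselect (letters i.+2 s').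
    by have [u [uRS us Du]] := Qi w' s' w'RS s'i; exists u; split=> // _.
  by exists id; split=> //; exact: rigid_surj_id.
- by move=> s' u w' uRS us Ds' s'i; apply: decided_comp => //; exact: Ds'.
pose st (t : seq 'I_i.+1) := rcons (s ++ map val t) i.+1.
have st_letters t : letters i.+2 (st t).
  move=> k; rewrite mem_rcons inE mem_cat si (ltnS k i.+1) (leq_eqVlt k i.+1).
  case: eqP => //= _; case: ltnP => //= ik; apply/negbTE/negP => /seq.mapP[a _ ka].
  by move: ik; rewrite ka leqNgt ltn_ord.
pose X := [set t : seq 'I_i.+1 | forall h, rigid_onto l h -> extends h (st t) ->
  Q true (h \o (u0 \o w))].
have XE t : ~ X t -> forall h, rigid_onto l h -> extends h (st t) ->
    Q false (h \o (u0 \o w)).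
  have [] := u0D (st t) _ _ (st_letters t).
  - by rewrite size_rcons size_cat ltnW // ltnS leq_addr.
  - by apply/allP => k; rewrite st_letters.
  - by move=> [|//] QX /(_ QX).
have [w0 [wv [eps epsP]]] := carlson_simpson X.
have labP (a : 'I_i.+1) : val a \in s by rewrite si ltn_ord.
have [v [vRS vfix vP]] := @substitution _ val s w0 wv (fun a _ => labP a)
  (fun _ a _ => labP a).
exists (v \o u0); split; [exact: rigid_surj_comp|exact: fixes_comp|].
exists eps => h hl hs; have [R [hR ltR]] := first_occurrence il si hl hs.
pose tau r : 'I_i.+1 := inord (h (size s + r)).
have := vP h tau R hs; rewrite hR => /(_ _)/wrap[r rR|hv].
  by rewrite /= inordK // ltR.
have hvl : rigid_onto l (h \o v) := rigid_onto_comp hl vRS.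
case: eps epsP => /(_ tau R)[X1 X2].
  exact: (X2 isT (h \o v)).
by apply: (XE (w0 ++ fill wv tau R) _ (h \o v)) => // /X1.
Qed.

Lemma settled_homogeneous Q l : settled Q l l -> forall w, rigid_surj w ->
  exists u, rigid_surj u /\
    exists eps, forall h, rigid_onto l h -> Q eps (h \o (u \o w)).
Proof.
move=> Ql w wRS.
have Q0 : settled Q l 0.
  suff H d : d <= l -> settled Q l (l - d) by rewrite -(subnn l); exact: H.
  elim: d => [|d IH] dl; first by rewrite subn0.
  by apply: settled_step; [lia|rewrite subnSK //; exact: IH (ltnW dl)].
have [//|u [uRS _ [eps Qeps]]] := Q0 w [::] wRS.
by exists u; split=> //; exists eps => h hl; exact: Qeps.
Qed.

(** * Borel sets are decided at words with all letters *)

(** Variables of an extension of [s] can be identified so that it continues by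
    any prescribed word [t] over the letters of [s]. *)
Lemma collapse s t : {subset t <= s} -> exists v,
  [/\ rigid_surj v, fixes (size s) v &
    forall h, extends h s -> extends (h \o v) (s ++ t)].
Proof.
move=> ts; have [//|v [vRS vfix vP]] := @substitution _ id s t (fun=> [::]) ts.
exists v; split=> // h hs.
have := vP h id 0 hs; rewrite cats0 map_id -cats1 => /(_ _)/wrap[//|].
exact: extends_cat.
Qed.

Lemma letters_onto l h s m : letters l s -> rigid_onto l h -> h m \in s.
Proof. by move=> sl hl; rewrite sl; exact: rigid_onto_lt hl. Qed.

Lemma extends_mkseq h s i : extends h s ->
  extends h (s ++ mkseq (fun m => h (size s + m)) i).
Proof.
move=> hs m; rewrite size_cat size_mkseq nth_cat.
case: (ltnP m (size s)) => [ms _|sm mi]; first exact: hs.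
by rewrite nth_mkseq ?subnKC //; lia.
Qed.

Section BorelSettled.
Variables (P : Type) (realizes : P -> (nat -> nat) -> Prop) (l : nat).

Definition side (X : set P) (eps : bool) : set (nat -> nat) :=
  [set g | forall p, realizes p g -> if eps then X p else ~ X p].

Lemma settled_sigma_algebra : sigma_algebra setT [set X | settled (side X) l l].
Proof.
split=> [w s wRS _|X XS w s wRS sl|X XS w s wRS sl].
- exists id; split=> //; first exact: rigid_surj_id.
  by exists false => h _ _ p _ [].
- have [u [uRS us [eps Xeps]]] := XS w s wRS sl; exists u; split=> //.
  exists (~~ eps) => h hl hs p pg; have := Xeps h hl hs p pg.
  by rewrite setTD; case: eps {Xeps} => //= Xp nXp.
(* The i-th set is decided at the extensions of s by i letters. *)
pose D s' w' := letters l s' ->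
  decided (side (X (size s' - size s))) l s' w'.
have [||u0 [u0RS u0fix u0D]] := @fusion l D (size s) _ _ w wRS.
- move=> s' w' _ w'RS; have [s'l|] := pselect (letters l s').
    have [u [uRS us Du]] := XS (size s' - size s) w' s' w'RS s'l.
    by exists u; split=> // _.
  by exists id; split=> //; exact: rigid_surj_id.
- by move=> s' u w' uRS us Ds' s'i; apply: decided_comp => //; exact: Ds'.
(* If some X_i is decided positively at s t, this settles the union at s; if
   all decisions are negative, no extension of s is in the union. *)
have [[t [ts tX]]|nX] := pselect (exists t, {subset t <= s} /\
    forall h, rigid_onto l h -> extends h (s ++ t) ->
      side (X (size t)) true (h \o (u0 \o w))).
  have [v [vRS vfix vP]] := collapse ts.
  exists (v \o u0); split; [exact: rigid_surj_comp|exact: fixes_comp|].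
  exists true => h hl hs p pg; exists (size t) => //.
  by apply: (tX (h \o v)); [exact: rigid_onto_comp|exact: vP|].
exists u0; split=> //; exists false => h hl hs p pg [i _ Xip].
pose t := mkseq (fun m => h (size s + m)) i.
have hst : extends h (s ++ t) by exact: extends_mkseq.
have ts : {subset t <= s}.
  by move=> k /seq.mapP[m _ ->]; exact: letters_onto hl.
have stl : letters l (s ++ t).
  move=> k; rewrite mem_cat sl; case: (boolP (k \in t)) => [/ts|]; last by rewrite orbF.
  by rewrite sl orbT => ->.
have [||eps Xeps] := u0D (s ++ t) _ _ stl.
- by rewrite size_cat leq_addr.
- by apply/allP => k; rewrite stl.
rewrite size_cat size_mkseq addKn in Xeps.
case: eps Xeps => Xeps; last by have /(_ Xip) := Xeps h hl hst p pg.
by apply: nX; exists t; split=> //; rewrite size_mkseq.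
Qed.

(** An initial segment of length [m] of [h \o w] is determined by the one of
    [h], as [w i <= i]. *)
Lemma settled_open (X : set P) :
  (forall p, X p -> exists m, forall p' g g', realizes p g -> realizes p' g' ->
     (forall i, i < m -> g' i = g i) -> X p') ->
  settled (side X) l l.
Proof.
move=> Xopen w s wRS sl.
have [[h [hl [hs [p [pg Xp]]]]]|nX] := pselect (exists h, rigid_onto l h /\
    extends h s /\ exists p, realizes p (h \o w) /\ X p); last first.
  exists id; split=> //; first exact: rigid_surj_id.
  exists false => h hl hs p pg Xp; apply: nX.
  by exists h; split=> //; split=> //; exists p.
have [m Xm] := Xopen p Xp.
pose t := mkseq (fun r => h (size s + r)) m.
have hst : extends h (s ++ t) by exact: extends_mkseq.
have ts : {subset t <= s}.
  by move=> k /seq.mapP[r _ ->]; exact: letters_onto hl.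
have [v [vRS vfix vP]] := collapse ts.
exists v; split=> //; exists true => h' hl' hs' p' pg'.
apply: (Xm p' _ _ pg pg') => i im /=.
have wi := rigid_le i wRS.1.
have ist : w i < size (s ++ t) by rewrite size_cat size_mkseq; lia.
by rewrite -[LHS]/((h' \o v) (w i)) (vP _ hs') // hst.
Qed.

End BorelSettled.

(** * Types of maps into a finite set *)

(** [tau.2] lists the values of [g] by first occurrence, followed by the
    letters that do not occur; [tau.1.+1] is the number of values. *)
Lemma rigid_factorization n (g : nat -> 'I_n.+1) :
  exists (tau : 'I_n.+1 * {perm 'I_n.+1}) (h : nat -> nat),
    rigid_onto (tau.1).+1 h /\ forall m, g m = tau.2 (inord (h m)).
Proof.
pose occurs a := `[< exists m, g m = a >].
have /choice[first firstP] a : exists p, occurs a ->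
    g p = a /\ forall m, g m = a -> p <= m.
  have [/asboolP occ|] := boolP (occurs a); last by exists 0.
  have ex : exists m, g m == a by have [m gm] := occ; exists m; apply/eqP.
  exists (ex_minn ex) => _; case: ex_minnP => m /eqP gm mmin.
  by split=> // m' /eqP; exact: mmin.
have occ_g m : occurs (g m) by apply/asboolP; exists m.
pose b1 := sort (relpre first leq) [seq a <- enum 'I_n.+1 | occurs a].
pose b := b1 ++ [seq a <- enum 'I_n.+1 | ~~ occurs a].
have mem_b1 a : (a \in b1) = occurs a.
  by rewrite mem_sort mem_filter mem_enum andbT.
have b_perm : perm_eq b (enum 'I_n.+1).
  rewrite /b; apply: perm_trans (permEl (perm_filterC occurs _)).
  by rewrite perm_cat2r /b1 perm_sort.
have b_uniq : uniq b by rewrite (perm_uniq b_perm) enum_uniq.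
have b_size : size b = n.+1 by rewrite (perm_size b_perm) size_enum_ord.
have b1_uniq : uniq b1 by move: b_uniq; rewrite cat_uniq => /and3P[].
have b1_size : size b1 <= n.+1.
  by apply: leq_trans (eq_leq b_size); rewrite size_cat leq_addr.
have b1_gt0 : 0 < size b1.
  by have := occ_g 0; rewrite -mem_b1; case: (b1).
have sig_inj : injective (fun i : 'I_n.+1 => nth ord0 b i).
  move=> i j /eqP; rewrite nth_uniq ?b_size // => /eqP; exact: val_inj.
pose h m := index (g m) b1.
have h_lt m : h m < size b1 by rewrite index_mem mem_b1 occ_g.
have h_first a : occurs a -> h (first a) = index a b1.
  by move=> /firstP[ga _]; rewrite /h ga.
exists (inord (size b1).-1, perm sig_inj), h; split; last first.
  move=> m; rewrite /= permE inordK; last exact: leq_trans (h_lt m) b1_size.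
  by rewrite nth_cat h_lt nth_index // mem_b1 occ_g.
rewrite /= inordK; last by rewrite prednK.
rewrite prednK //; split=> [m k khm|k]; last first.
  split=> [[m <-]|kb1]; first exact: h_lt.
  exists (first (nth ord0 b1 k)).
  by rewrite h_first ?index_uniq // -mem_b1 mem_nth.
have kb1 : k < size b1 := ltn_trans khm (h_lt m).
set a := nth ord0 b1 k; have occ_a : occurs a by rewrite -mem_b1 mem_nth.
exists (first a); last by rewrite h_first // index_uniq.
have [ga _] := firstP _ occ_a; have [gg gmin] := firstP _ (occ_g m).
apply: leq_trans (gmin _ erefl); rewrite ltn_neqAle; apply/andP; split.
  apply/eqP => faE; have : h (first a) = h (first (g m)) by rewrite faE.
  by rewrite !h_first // index_uniq // => kE; move: khm; rewrite /h -kE ltnn.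
have : sorted (relpre first leq) b1.
  by apply: sort_sorted => x y; exact: leq_total.
move=> /(sorted_ltn_nth (fun x y z => @leq_trans _ _ _) ord0).
move=> /(_ _ _ kb1 (h_lt m) khm).
by rewrite /= nth_index // mem_b1.
Qed.

(** Homogeneity is inherited by refinements, so it can be achieved for finitely
    many partitions in turn. *)
Lemma common_homogeneous (J : eqType) (l : J -> nat)
    (Q : J -> bool -> set (nat -> nat)) (s : seq J) :
  (forall j, settled (Q j) (l j) (l j)) ->
  exists w, rigid_surj w /\ forall j, j \in s ->
    exists eps, forall h, rigid_onto (l j) h -> Q j eps (h \o w).
Proof.
move=> Qsettled; elim: s => [|j s [w [wRS ws]]].
  by exists id; split=> //; exact: rigid_surj_id.
have [u [uRS uj]] := settled_homogeneous (Qsettled j) wRS.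
exists (u \o w); split; first exact: rigid_surj_comp.
move=> i; rewrite inE => /predU1P[->//|/ws[eps Qeps]].
by exists eps => h hl; apply: (Qeps (h \o u)); exact: rigid_onto_comp.
Qed.

(** * Terms and the topology on epimorphisms *)

Section Terms.
Variable Om : language.
Implicit Types A B F : algebra Om.

Lemma hom_term_eval A B (h : A -> B) (v : nat -> A) t :
  homomorphism h -> h (term_eval v t) = term_eval (h \o v) t.
Proof.
move=> hM; elim: t => [//|f ts IH] /=.
by rewrite hM; congr op; apply/funext => i; exact: IH.
Qed.

Lemma term_eval_finite (t : term Om) : exists m, forall A (v v' : nat -> A),
  (forall i, i < m -> v i = v' i) -> term_eval v t = term_eval v' t.
Proof.
elim: t => [i|f ts /choice[m mP]].
  by exists i.+1 => A v v' vv'; exact: vv'.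
exists (\max_i m i) => A v v' vv' /=; congr op; apply/funext => i.
by apply: mP => j ji; apply: vv'; exact: leq_trans ji (leq_bigmax i).
Qed.

(** The values of terms form a subalgebra, which is again in the variety; the
    retraction onto it given by freeness is the identity by uniqueness. *)
Lemma freely_generated_term (V : algebra Om -> Prop) F (x : nat -> F) :
  variety V -> freely_generated V x -> forall y, exists t, term_eval x t = y.
Proof.
move=> [E VE] [VF xfree].
pose S := {y : F | exists t, term_eval x t = y}.
have opP f (a : 'I_(arity f) -> S) :
    exists t, term_eval x t = op F f (fun i => sval (a i)).
  have /choice[ts tsP] i : exists t, term_eval x t = sval (a i) := svalP (a i).
  by exists (App ts) => /=; congr op; apply/funext.
have gen i : exists t, term_eval x t = x i by exists (Var Om i).
pose B := @Algebra Om S (fun f a => exist _ _ (opP f a))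
  (inhabits (exist _ _ (gen 0))).
have valM : @homomorphism Om B F sval by [].
have val_inj' (y z : B) : sval y = sval z -> y = z.
  case: y z => [y yP] [z zP] /= yz; subst z; congr exist; exact: Prop_irrelevance.
have VB : V B.
  apply/VE => e Ee v; apply: val_inj'; rewrite !(hom_term_eval _ _ valM).
  by move/VE: VF => /(_ e Ee).
have [h [[hM hx] _]] := xfree B VB (fun i => exist _ _ (gen i)).
have [k [_ kuniq]] := xfree F VF x.
have svalh : sval \o h = idfun.
  rewrite -(kuniq (sval \o h)) ?(kuniq idfun) //; split=> [f a|i] /=.
    by rewrite hM valM.
  by rewrite hx.
move=> y; have [t ty] := svalP (h y); exists t.
by rewrite ty -[RHS]/(idfun y) -svalh.
Qed.

(** A basic neighbourhood prescribes finitely many values, each of which is the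
    value of a term and hence depends on finitely many generators. *)
Lemma epi_open A B (x : nat -> A) (U : set (epi A B)) (phi : epi A B) :
  (forall y, exists t, term_eval x t = y) -> open U -> U phi ->
  exists m, forall psi : epi A B,
    (forall i, i < m -> set_val psi (x i) = set_val phi (x i)) -> U psi.
Proof.
move=> gen [W oW WU] Uphi.
pose agree m := [set psi : epi A B |
  forall i, i < m -> set_val psi (x i) = set_val phi (x i)].
(* the filter of the sets [agree m], which converges to phi *)
pose G : set_system {ptws A -> discrete_topology {classic B}} :=
  [set Q | exists m, agree m `<=` set_val @^-1` Q].
have FG : Filter G.
  split; first by exists 0.
    move=> P Q [m mP] [m' m'Q]; exists (maxn m m') => psi psiE; split.
      by apply: mP => i im; apply: psiE; rewrite leq_max im.
    by apply: m'Q => i im; apply: psiE; rewrite leq_max im orbT.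
  by move=> P Q PQ [m mP]; exists m => psi /mP; exact: PQ.
have Gphi : G --> (set_val phi : {ptws A -> discrete_topology {classic B}}).
  apply/cvg_sup => y Y [_ [[Z _ <-] /= Zy] ZY].
  have [t ty] := gen y; have [m mP] := term_eval_finite t.
  exists m => psi psiE; apply: ZY => /=.
  have evalE (rho : epi A B) :
      set_val rho y = term_eval (set_val rho \o x : nat -> B) t.
    by rewrite -ty; apply: hom_term_eval; have [] := set_mem (valP rho).
  have <- : set_val phi y = set_val psi y.
    by rewrite !evalE; apply: mP => i im; rewrite /= psiE.
  exact: Zy.
have : G W by apply: Gphi; apply: open_nbhs_nbhs; split=> //; rewrite -WU in Uphi.
by move=> [m mW]; exists m => psi psiE; rewrite -WU; exact: mW.
Qed.

End Terms.

(** * Colourings of the epimorphisms from a free algebra *)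

Lemma reindexing_epi (Om : language) (V : algebra Om -> Prop) (F : algebra Om)
    (x : nat -> F) (w : nat -> nat) :
  variety V -> freely_generated V x -> (forall k, exists m, w m = k) ->
  exists h : epi F F, forall i, set_val h (x i) = x (w i).
Proof.
move=> Vvar Ffree wS; have gen := freely_generated_term Vvar Ffree.
have [VF xfree] := Ffree.
have [h [[hM hx] _]] := xfree F VF (x \o w).
have /choice[r rP] := wS.
have hE : epimorphism h.
  split=> // y; have [t <-] := gen y; exists (term_eval (x \o r) t).
  rewrite (hom_term_eval _ _ hM); congr term_eval; apply/funext => i /=.
  by rewrite hx /= rP.
by exists (exist (fun g => g \in @epi_set Om F F) h
  (mem_set (hE : @epi_set Om F F h))).
Qed.

Lemma borel_settled (Om : language) (A B : algebra Om) (x : nat -> A)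
    (c : nat -> B) l (X : set (epi A B)) :
  (forall y, exists t, term_eval x t = y) ->
  <<s [set U : set (epi A B) | open U] >> X ->
  settled (side (fun (p : epi A B) g => forall i, set_val p (x i) = c (g i)) X) l l.
Proof.
move=> gen XB.
apply: (smallest_sub (settled_sigma_algebra
  (fun (p : epi A B) g => forall i, set_val p (x i) = c (g i)) l) _ XB).
move=> U oU; apply: settled_open => p Up.
have [m mP] := epi_open gen oU Up; exists m => p' g g' pg pg' gg'.
by apply: mP => i im; rewrite pg pg' gg'.
Qed.

Lemma free_algebra_ramsey_bound (Om : language) (V : algebra Om -> Prop)
    (F A : V_epi V) (x : nat -> sval F) n :
  variety V -> freely_generated V x -> [set: carrier (sval A)] #= `I_n ->
  0 < n /\ dual_ramsey_bound A F (n * n`!).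
Proof.
move=> Vvar Ffree A_card; have gen := freely_generated_term Vvar Ffree.
have [a0] := algebra_nonempty (sval A).
case: n A_card => [|n] A_card.
  by exfalso; move: A_card; rewrite II0 card_eq0 => /eqP/seteqP[/(_ a0 I)].
have [e eP] : exists e : 'I_n.+1 -> sval A, forall a, exists i, e i = a.
  move: A_card; rewrite card_eq_le => /andP[/pfcard_geP[A0|[f]] _].
    by exfalso; have : [set: sval A] a0 by []; rewrite A0.
  exists (fun i => f (val i)) => a.
  have [m mn <-] := @surj _ _ _ _ f a I.
  by exists (Ordinal (mn : m < n.+1)).
split=> // k k2 chi chiB.
pose J := ('I_n.+1 * {perm 'I_n.+1})%type.
pose letter (tau : J) m := e (tau.2 (inord m)).
pose real (tau : J) (p : epi (sval F) (sval A)) g :=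
  forall i, set_val p (x i) = letter tau (g i).
have [w [wRS wP]] := @common_homogeneous (J * 'I_k)%type
  (fun j => (j.1.1).+1) (fun j => side (real j.1) (chi @^-1` [set j.2]))
  (enum {: J * 'I_k})
  (fun j => @borel_settled _ _ _ x (letter j.1) (j.1.1).+1 _ gen (chiB j.2)).
have [wh whP] := reindexing_epi Vvar Ffree wRS.2.
exists wh.
have realw tau (f : epi (sval F) (sval A)) h :
    real tau f h -> real tau (epi_comp f wh) (h \o w).
  by move=> fh i; rewrite -[RHS](fh (w i)) -whP.
(* D tau is the common colour of the epimorphisms of type tau; types whose
   letters do not generate A have none and get an arbitrary colour. *)
have /choice[D DP] : forall tau : J, exists i, forall (f : hom F A) h,
    rigid_onto (tau.1).+1 h -> real tau f h -> chi (compm f wh) = i.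
  move=> tau.
  have [[f [h [hl fh]]]|nf] := pselect (exists (f : hom F A) h,
      rigid_onto (tau.1).+1 h /\ real tau f h); last first.
    exists (Ordinal (ltnW k2)) => f h hl fh; exfalso; apply: nf.
    by exists f, h.
  exists (chi (compm f wh)) => f' h' hl' fh'.
  have [|eps Qeps] := wP (tau, chi (compm f wh)); first by rewrite mem_enum.
  have := Qeps h hl _ (realw _ _ _ fh).
  case: eps Qeps => [Qeps _|_ /(_ erefl)//].
  exact: Qeps h' hl' _ (realw _ _ _ fh').
have tau0 : J := (ord0, 1%g).
have cardJ : #|{: J}| = n.+1 * n.+1`!.
  by rewrite card_prod card_ord card_Sn.
pose colour m := D (nth tau0 (enum {: J}) m).
apply: (@card_le_trans _ _ _ (colour @` `I_(n.+1 * n.+1`!))).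
  apply: subset_card_le => _ [f _ <-].
  have /choice[g gP] m :
      exists i, e i = set_val (f : epi (sval F) (sval A)) (x m) by [].
  have [tau [h [hl gE]]] := rigid_factorization g.
  exists (enum_rank tau); first by rewrite /= -cardJ.
  rewrite /colour nth_enum_rank -(DP tau f h hl) // => i.
  by rewrite -gP gE.
exact: card_image_le.
Qed.

Theorem corollary4p17 (Om : language) (Om_countable : countable [set: symbol Om])
    (V : algebra Om -> Prop) (V_variety : variety V) (V_nontrivial : nontrivial V)
    (F : V_epi V) (x : nat -> sval F) (F_free : freely_generated V x)
    (A : V_epi V) (n : nat) (A_card : [set: carrier (sval A)] #= `I_n) :
  exists2 d : nat, big_dual_ramsey_degree A F = Some d & d <= n * n`!.
Proof.
have [n_gt0 bound] := free_algebra_ramsey_bound V_variety F_free A_card.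
have good : (0 < n * n`!) && `[< dual_ramsey_bound A F (n * n`!) >].
  by rewrite muln_gt0 n_gt0 fact_gt0; apply/asboolP.
rewrite /big_dual_ramsey_degree; case: pselect => [ex|[]]; last by exists (n * n`!).
by exists (ex_minn ex) => //; case: ex_minnP => d _; exact.
Qed.
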